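(* Let $n\ge 1$, let $A,B$ be $n\times n$ complex Hermitian matrices, and fix an integer $k\ge 1$. Put $H=A+B$, \[ Q_k=\sum_{p=0}^k\binom{k}{p}A^pB^{k-p},\qquad R_k=\operatorname{Re}Q_k=\tfrac12(Q_k+Q_k^* ),\qquad D_k=R_k-H^k . \] For each $r=1,\dots,n$, let $E_{k,r}$ be a spectral projection of $H^k$ associated with its $r$ largest eigenvalues. If \[ \operatorname{Tr}(E_{k,r}D_k)\ge 0\qquad\text{for all } r=1,\dots,n, \] then $\lambda(H^k)\prec_w\lambda(R_k)$.
   Context: For a Hermitian matrix $F$, a spectral projection of $F$ associated with its $r$ largest eigenvalues means an orthogonal projection onto an $r$-dimensional subspace spanned by eigenvectors of $F$ corresponding to the $r$ largest eigenvalues (counting multiplicities). For an $n\times n$ Hermitian matrix $M$, $\lambda(M)=(\lambda_1(M),\dots,\lambda_n(M))$ is the vector of eigenvalues, counted with multiplicity, in nonincreasing order. For $x,y\in\mathbb{R}^n$ with entries in nonincreasing order, $x\prec_w y$ ($x$ is weakly majorized by $y$) means $\sum_{i=1}^r x_i\le\sum_{i=1}^r y_i$ for all $r=1,\dots,n$. *)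

(* Defs.v *)
From HB Require Import structures.
From mathcomp Require Import all_boot all_order all_algebra.
From mathcomp Require Import spectral sesquilinear complex reals.

Set Implicit Arguments.
Unset Strict Implicit.
Unset Printing Implicit Defensive.

Import Order.TTheory GRing.Theory Num.Theory.
Local Open Scope ring_scope.
Local Open Scope complex_scope.
Local Open Scope sesquilinear_scope.

(* Eigenvalues with multiplicity, in nonincreasing order.  The roots of the
   characteristic polynomial of a Hermitian matrix are real, so taking real
   parts loses nothing: see [char_poly_eigvals]. *)
Definition eigvals (R : rcfType) (n : nat) (M : 'M[R[i]]_n) : seq R :=
  sort (fun x y => y <= x)
    [seq complex.Re z | z <- sval (closed_field_poly_normal (char_poly M))].

Lemma size_eigvals (R : rcfType) (n : nat) (M : 'M[R[i]]_n) :
  size (eigvals M) = n.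
Proof.
rewrite size_sort size_map; case: closed_field_poly_normal => s /= E.
move: (size_char_poly M); rewrite E (monicP (char_poly_monic M)) scale1r.
by rewrite size_prod_XsubC => -[].
Qed.

Lemma eigvals_sorted (R : rcfType) (n : nat) (M : 'M[R[i]]_n) :
  sorted (fun x y => y <= x) (eigvals M).
Proof. by apply: sort_sorted => x y; exact: le_total. Qed.

Lemma eigenvalue_hermitian_real (C : numClosedFieldType) (n : nat)
    (M : 'M[C]_n) (a : C) :
  M \is hermsymmx -> eigenvalue M a -> a \is Num.real.
Proof.
move=> Mh /eigenvalueP [v vM v0].
have /orthomx_spectralP Msp := hermitian_normalmx Mh.
set P := spectralmx M in Msp; set d := spectral_diag M in Msp.
have PU : P \in unitmx := spectral_unit M.
pose w := v *m invmx P.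
have wd : w *m diag_mx d = a *: w.
  have := congr1 (mulmx^~ (invmx P)) vM.
  by rewrite {1}Msp !mulmxA mulmxK // -scalemxAl.
have /rV0Pn [j wj] : w != 0.
  by apply: contraNneq v0 => w0; rewrite -(mulmxKV PU v) -/w w0 mul0mx.
have /rowP /(_ j) := wd.
rewrite mul_mx_diag mxE [RHS]mxE mulrC => dj; rewrite -(mulIf wj dj).
exact: (mxOverP (hermitian_spectral_diag_real Mh)).
Qed.

Lemma char_poly_eigvals (R : rcfType) (n : nat) (M : 'M[R[i]]_n) :
  M \is hermsymmx ->
  char_poly M = \prod_(x <- eigvals M) ('X - (x%:C)%:P).
Proof.
move=> Mh; rewrite /eigvals; case: closed_field_poly_normal => s /= E.
rewrite (perm_big _ (permEl (perm_sort _ _))) big_map /=.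
rewrite [LHS]E (monicP (char_poly_monic M)) scale1r.
rewrite !big_seq; apply: eq_bigr => z zs; congr (_ - _%:P).
apply/esym/RRe_real; apply: (eigenvalue_hermitian_real Mh).
rewrite eigenvalue_root_char E (monicP (char_poly_monic M)) scale1r.
by rewrite root_prod_XsubC.
Qed.

Definition orthogonal_projection (C : numClosedFieldType) (n : nat)
    (E : 'M[C]_n) : Prop :=
  E *m E = E /\ E ^t* = E.

(* The columns of V are linearly independent eigenvectors of F for its r
   largest eigenvalues, and E projects orthogonally onto their span.  The
   transposes turn MathComp's row spaces into column spaces. *)
Definition spectral_projection (R : rcfType) (n : nat) (F : 'M[R[i]]_n)
    (r : nat) (E : 'M[R[i]]_n) : Prop :=
  orthogonal_projection E /\
  exists V : 'M[R[i]]_(n, r),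
    [/\ \rank V = r,
        forall j : 'I_r, F *m col j V = ((eigvals F)`_j)%:C *: col j V
      & (E^T :=: V^T)%MS].

(* Meant for sequences of length n in nonincreasing order. *)
Definition weakly_majorized (R : numDomainType) (n : nat) (x y : seq R) :
    Prop :=
  forall r : nat, (1 <= r <= n)%N ->
    \sum_(i < r) x`_i <= \sum_(i < r) y`_i.

Definition binomial_mx (C : pzRingType) (n : nat) (A B : 'M[C]_n) (k : nat) :
    'M[C]_n :=
  \sum_(p < k.+1) ((A ^+ p *m B ^+ (k - p)) *+ 'C(k, p)).

Definition re_mx (C : numClosedFieldType) (n : nat) (Q : 'M[C]_n) : 'M[C]_n :=
  2^-1 *: (Q + Q ^t*).

(* Main.v *)
Require Import Defs.
From mathcomp Require Import all_boot all_order all_algebra.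
From mathcomp Require Import spectral sesquilinear complex reals.
Import Order.TTheory GRing.Theory Num.Theory.
Local Open Scope ring_scope.
Local Open Scope complex_scope.
Local Open Scope sesquilinear_scope.

(** Summing the eigenvalue equations gives [\tr (E_r H^k)] as the sum of the
    [r] largest eigenvalues of [H^k], while Ky Fan's principle bounds
    [\tr (E_r R_k)] by the sum of the [r] largest eigenvalues of [R_k]; the
    difference of the two traces is nonnegative by hypothesis.  For Ky Fan,
    diagonalize [R_k = U^* diag(d) U]: the diagonal entries of [U E_r U^*] are
    weights in [0, 1] of total mass [r], and the average of [d] against such
    weights is largest when they are concentrated on the top [r] entries. *)

Lemma weighted_sum_le (R : realDomainType) (I : finType) (d g : I -> R)
    (s : seq R) (r : nat) :
  sorted (fun x y => y <= x) s -> perm_eq s [seq d i | i : I] ->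
  (forall i, 0 <= g i <= 1) -> \sum_i g i = r%:R -> (0 < r <= size s)%N ->
  \sum_i g i * d i <= \sum_(i < r) s`_i.
Proof.
move=> ss sd g01 gr /andP[r0 rs].
have tr : transitive (fun x y : R => y <= x).
  by move=> y x z yx zy; apply: le_trans zy yx.
have rf : reflexive (fun x y : R => y <= x) by move=> x; apply: lexx.
have decr i j : (i <= j)%N -> (j < size s)%N -> s`_j <= s`_i.
  move=> ij js; apply: (sorted_leq_nth tr rf 0 ss) => //.
  exact: leq_ltn_trans ij js.
(* Comparing with the threshold [m], the [r]-th largest value, replaces [d]
   by its positive excess over [m], whose sum depends only on the multiset of
   values. *)
pose m := s`_r.-1.
have -> : \sum_i g i * d i = \sum_i g i * (d i - m) + r%:R * m.
  by rewrite -gr mulr_suml -big_split /=; apply: eq_bigr => i _;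
    rewrite -mulrDr subrK.
have -> : \sum_(i < r) s`_i = \sum_(i < r) (s`_i - m) + r%:R * m.
  by rewrite sumrB sumr_const card_ord mulr_natl subrK.
rewrite lerD2r.
(* A weight in [[0, 1]] shrinks a nonnegative excess and makes a negative one at most [0]. *)
have excess i : g i * (d i - m) <= Num.max (d i - m) 0.
  have /andP[g0 g1] := g01 i; rewrite le_max.
  have [dm|/ltW dm] := leP 0 (d i - m); first by rewrite ler_piMl.
  by rewrite (mulr_ge0_le0 g0 dm) orbT.
apply: le_trans (ler_sum _ (fun i _ => excess i)) _.
have -> : \sum_i Num.max (d i - m) 0 = \sum_(x <- s) Num.max (x - m) 0.
  by rewrite (perm_big _ sd) big_map big_enum.
(* Split [s] after its first [r] entries: these are at least [m], so the maximum is the excess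
   itself; later entries are at most [m] and contribute [0]. *)
rewrite (big_nth 0) (@big_cat_nat _ _ _ r) //= addrC big1_seq ?add0r.
  rewrite big_mkord; apply: ler_sum => i _.
  rewrite max_l // subr_ge0 decr //; first by rewrite -ltnS prednK.
  by rewrite (leq_trans _ rs) // prednK.
move=> i /=; rewrite mem_index_iota => /andP[ri is_].
by rewrite max_r // subr_le0 decr // (leq_trans (leq_pred _)).
Qed.

Lemma char_poly_conj (C : comUnitRingType) (n : nat) (P D : 'M[C]_n) :
  P \in unitmx -> char_poly (invmx P *m D *m P) = char_poly D.
Proof.
move=> PU; rewrite /char_poly /char_poly_mx.
set f := map_mx _.
have fK : f (invmx P) *m f P = 1%:M by rewrite -map_mxM mulVmx // map_mx1.
have -> : 'X%:M - f (invmx P *m D *m P)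
          = f (invmx P) *m ('X%:M - f D) *m f P.
  rewrite /f !map_mxM mulmxBr mulmxBl; congr (_ - _).
  by rewrite scalar_mxC -mulmxA fK mulmx1.
by rewrite !det_mulmx mulrAC -det_mulmx fK det1 mul1r.
Qed.

(** Both lists give the roots of [char_poly M], and a product of monic linear factors determines its
    roots up to order. *)
Lemma eigvals_spectral_diag (R : rcfType) (n : nat) (M : 'M[R[i]]_n) :
  M \is hermsymmx ->
  perm_eq (eigvals M) [seq complex.Re (spectral_diag M 0 i) | i : 'I_n].
Proof.
move=> Mh.
have /orthomx_spectralP Msp := hermitian_normalmx Mh.
have cp : char_poly M = \prod_(i < n) ('X - (spectral_diag M 0 i)%:P).
  rewrite [in LHS]Msp char_poly_conj ?spectral_unit //.
  rewrite char_poly_trig ?diag_mx_is_trig //.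
  by apply: eq_bigr => i _; rewrite mxE eqxx mulr1n.
have /(perm_map (@complex.Re R)) : perm_eq [seq x%:C | x <- eigvals M]
    [seq spectral_diag M 0 i | i : 'I_n].
  apply: prod_XsubC_eq.
  by rewrite !big_map -char_poly_eigvals // cp big_enum.
by rewrite -!(map_comp (@complex.Re R)) (eq_map (_ : _ =1 id)) ?map_id.
Qed.

(** From [G = G *m G ^t*], the entry [G i i] is the squared norm of row [i], hence at least
    [G i i ^+ 2]. *)
Lemma diag_projection_bounds (C : numClosedFieldType) (n : nat) (G : 'M[C]_n)
    (i : 'I_n) :
  orthogonal_projection G -> 0 <= G i i <= 1.
Proof.
case=> GG Gh.
have Gii : G i i = \sum_j `|G i j| ^+ 2.
  rewrite -{1}GG mxE; apply: eq_bigr => j _.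
  by rewrite normCK; congr (_ * _); rewrite -{1}Gh !mxE.
have G0 : 0 <= G i i.
  by rewrite Gii; apply: sumr_ge0 => j _; rewrite exprn_ge0.
rewrite G0 /=.
have : G i i ^+ 2 <= G i i.
  rewrite {2}Gii (bigD1 i) //= (ger0_norm G0) lerDl.
  by apply: sumr_ge0 => j _; rewrite exprn_ge0.
have [->|Gn0] := eqVneq (G i i) 0; first by rewrite ler01.
by rewrite expr2 ger_pMl // lt_def Gn0.
Qed.

Lemma orthogonal_projection_unitary (C : numClosedFieldType) (n : nat)
    (P E : 'M[C]_n) :
  P \is unitarymx -> orthogonal_projection E ->
  orthogonal_projection (P *m E *m P ^t*).
Proof.
move=> PU [EE Eh]; split; first by rewrite !mulmxA mulmxKtV // -(mulmxA P) EE.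
by rewrite !trmx_mul !map_mxM trmxCK Eh mulmxA.
Qed.

Lemma ky_fan (R : rcfType) (n : nat) (M E : 'M[R[i]]_n) (r : nat) :
  M \is hermsymmx -> orthogonal_projection E -> \tr E = r%:R ->
  (0 < r <= n)%N -> \tr (E *m M) <= (\sum_(i < r) (eigvals M)`_i)%:C.
Proof.
move=> Mh Ep trE rn.
have /orthomx_spectralP := hermitian_normalmx Mh.
set P := spectralmx M; set d := spectral_diag M => Msp.
have PU : P \is unitarymx := spectral_unitarymx M.
pose G := P *m E *m P ^t*.
have Gb i : 0 <= G i i <= 1.
  exact/diag_projection_bounds/orthogonal_projection_unitary.
pose g i := complex.Re (G i i); pose dr i := complex.Re (d 0 i).
(* In [R[i]] the bound [0 <= z] already forces [z] to be real. *)
have gE i : G i i = (g i)%:C.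
  by rewrite RRe_real //; case/andP: (Gb i) => /ger0_real.
have dE i : d 0 i = (dr i)%:C.
  by rewrite RRe_real // (mxOverP (hermitian_spectral_diag_real Mh)).
have -> : \tr (E *m M) = (\sum_i g i * dr i)%:C.
  rewrite Msp invmx_unitary // mulmxA mxtrace_mulC !mulmxA -/G.
  rewrite rmorph_sum; apply: eq_bigr => i _.
  by rewrite mul_mx_diag mxE gE dE rmorphM.
rewrite lecR; apply: weighted_sum_le.
- exact: eigvals_sorted.
- exact: eigvals_spectral_diag.
- by move=> i; rewrite -!lecR -gE.
(* The weights sum to [\tr G], which equals [\tr E] by cyclicity. *)
- apply: (@complexI R); rewrite rmorph_sum rmorph_nat -trE.
  rewrite -[E](mulmxKtV _ PU) // mxtrace_mulC.
  by rewrite mulmxA; apply: eq_bigr => i _; exact: (esym (gE i)).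
- by rewrite size_eigvals.
Qed.

(** Factor [E = V *m X^T] with [X^T *m V = 1]; cyclicity then reduces both traces to those of [r] by
    [r] matrices, the identity and the diagonal of eigenvalues. *)
Lemma spectral_projection_trace (R : rcfType) (n : nat) (F E : 'M[R[i]]_n)
    (r : nat) :
  spectral_projection F r E ->
  \tr E = r%:R /\ \tr (E *m F) = (\sum_(i < r) (eigvals F)`_i)%:C.
Proof.
case=> -[EE _] [V [rV FV EV]].
have /submxP[X /(congr1 trmx)] : (E^T <= V^T)%MS by rewrite EV.
rewrite trmxK trmx_mul trmxK => EX.
have /submxP[Y /(congr1 trmx)] : (V^T <= E^T)%MS by rewrite EV.
rewrite trmxK trmx_mul trmxK => VY.
(* [E] fixes the columns of [V], so [V *m (X^T *m V) = V], and [V] cancels since its columns are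
   independent. *)
have XV : X^T *m V = 1%:M.
  have Vfree : row_free V^T by rewrite /row_free mxrank_tr rV.
  apply/trmx_inj/(row_free_inj Vfree); rewrite -!trmx_mul.
  by rewrite mulmxA -EX mulmx1 VY mulmxA EE.
have FVd : F *m V = V *m diag_mx (\row_j ((eigvals F)`_j)%:C).
  apply/matrixP => i j; rewrite mul_mx_diag !mxE mulrC.
  by have /colP/(_ i) := FV j; rewrite [in LHS]colE mulmxA -colE !mxE.
split; first by rewrite EX mxtrace_mulC XV mxtrace1.
rewrite mxtrace_mulC EX mulmxA FVd mxtrace_mulC mulmxA XV mul1mx.
by rewrite mxtrace_diag rmorph_sum; apply: eq_bigr => j _; rewrite mxE.
Qed.

Lemma re_mx_hermitian (C : numClosedFieldType) (n : nat) (Q : 'M[C]_n) :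
  re_mx Q \is hermsymmx.
Proof.
apply/is_hermitianmxP; rewrite expr0 scale1r /re_mx.
apply/matrixP => i j; rewrite !mxE rmorphM rmorphD /= conjCK addrC.
by rewrite fmorphV rmorph_nat.
Qed.

Theorem proposition5p1 (R : realType) (n : nat) (hn : (1 <= n)%N)
    (A B : 'M[R[i]]_n) (hA : A \is hermsymmx) (hB : B \is hermsymmx)
    (k : nat) (hk : (1 <= k)%N) (E : nat -> 'M[R[i]]_n) :
  let H := A + B in
  let Rk := re_mx (binomial_mx A B k) in
  let Dk := Rk - H ^+ k in
  (forall r : nat, (1 <= r <= n)%N -> spectral_projection (H ^+ k) r (E r)) ->
  (forall r : nat, (1 <= r <= n)%N -> 0 <= \tr (E r *m Dk)) ->
  weakly_majorized n (eigvals (H ^+ k)) (eigvals Rk).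
Proof.
move=> H Rk Dk hE hD r rn; rewrite -lecR.
have Esp := hE r rn; have [trE <-] := spectral_projection_trace _ _ _ _ _ Esp.
have := hD r rn; rewrite /Dk mulmxBr linearB /= subr_ge0 => /le_trans; apply.
by apply: ky_fan => //; [exact: re_mx_hermitian | case: Esp].
Qed.
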